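(* Assume the following conditions. (i) There exist positive absolute constants $\xi_1,\xi_2,\xi_3$ such that, for every sufficiently large $n$ and every $\theta\in\Theta_n$, $$P_\star^{(n)}\left[\exp(-\lambda\{\ell_n(\theta)-\ell_n^\star\})\right]\le \exp(-\xi_1\mathcal L_n(\theta)),\qquad P_\star^{(n)}\left[\exp(\lambda\xi_2\{\ell_n(\theta)-\ell_n^\star\})\right]\le \exp(\xi_3\mathcal L_n(\theta)).$$ (ii) There exists an absolute constant $\xi_4>0$ such that, for every sufficiently large $n$ and every $k\in[M_n]$, there is a distribution $Q^*_{n,k}\in\mathcal Q_{n,k}$ with $$\log\left(\int\exp(\xi_3\mathcal L_n(\theta))\,dQ^*_{n,k}(\theta)\right)\le \xi_4\mathcal E_n(k),\qquad \mathrm{KL}(Q^*_{n,k},\Pi_{n,k})\le\xi_4\mathcal E_n(k).$$ Let $\tau_*>0$ and $C_2>0$ be absolute constants such that, for every sufficiently large $n$, $$P_\star^{(n)}\left(\widehat m_n\ge \min\{k_n^\dagger(\tau_* )+1,M_n\}\right)\ge 1-k_n^\dagger(\tau_* )\exp\left(-C_2\,\mathcal E_n(k_n^\dagger(\tau_* ))\right)$$ (under (i) and (ii) such constants exist). Write $k_n^\dagger=k_n^\dagger(\tau_* )$, $\mathcal E_n^*:=\min\{\mathcal E_n(k):k\in[M_n],\ k\le k_n^\dagger+1\}$, and, for $\nu>0$, $$k_n^\circ(\nu):=\sup\{k\in[M_n]\setminus[k_n^\dagger-1]:\mathcal E_n(k)\le(1+\nu)\mathcal E_n^*\}\vee k_n^\dagger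 .$$ Then there exist absolute constants $\nu_*>0$ and $C_3>0$ such that, for every sufficiently large $n$, $$P_\star^{(n)}\left(\widehat m_n\le k_n^\circ(\nu_* )+1\right)\ge 1-2\exp(-C_3\mathcal E_n^* ).$$
   Context: Setup. For each $n$, a sample $X^{(n)}$ with values in a measurable space $\mathcal X_n$ is drawn from the true distribution $P_\star^{(n)}$; $P_\star^{(n)}[\cdot]$ denotes expectation and $P_\star^{(n)}(\cdot)$ probability under it. $\mathcal P(\cdot)$ is the set of probability measures on a space; $[m]=\{1,\dots,m\}$, $[0]=\emptyset$. The models are parameter spaces $\Theta_{n,1},\dots,\Theta_{n,M_n}$, each $\theta$ indexing a distribution $P_\theta^{(n)}\in\mathcal P(\mathcal X_n)$, and they are nested: for each $k<M_n$ there is an embedding $T:\Theta_{n,k}\to\Theta_{n,k+1}$ with $P^{(n)}_\theta=P^{(n)}_{T(\theta)}$ for all $\theta\in\Theta_{n,k}$. Put $\Theta_n=\bigcup_{k=1}^{M_n}\Theta_{n,k}$. A loss $\ell_n:\mathcal P(\mathcal X_n)\times\mathcal X_n\to[0,\infty)$ is given; write $\ell_n(\theta)=\ell_n(P_\theta^{(n)},X^{(n)})$ and $\ell_n^\star=\ell_n(P_\star^{(n)},X^{(n)})$. The excess risk is $\mathcal L_n(\theta)=P_\star^{(n)}[\ell_n(\theta)-\ell_n^\star]$. $\mathrm{KL}(P_1,P_2)=\int\log(dP_1/dP_2)\,dP_1$ if $P_1\ll P_2$, and $\infty$ otherwise. ''Absolute constant'' means a constant not depending on $n$ or $k$. A supremum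 over the empty set is $-\infty$. Variational Bayes. $\lambda>0$ is a fixed constant (learning rate). For each $k\in[M_n]$, $\Pi_{n,k}$ is a prior distribution on $\Theta_{n,k}$ and $\mathcal Q_{n,k}\subset\mathcal P(\Theta_{n,k})$ is a variational family. The variational posterior $\widehat Q_{n,k}$ is a minimizer over $Q\in\mathcal Q_{n,k}$ of $\lambda\int\ell_n(\theta)\,dQ(\theta)+\mathrm{KL}(Q,\Pi_{n,k})$, and $\mathrm{mVFE}_n(k)$ is the minimum value. Stopping index: $\widehat m_n=\inf\{k\in[M_n]\setminus\{1\}:\mathrm{mVFE}_n(k-1)<\mathrm{mVFE}_n(k)\}\wedge M_n$ (with $\inf\emptyset=\infty$). Excess risk of model $k$: $\mathcal E_n(k)=-\log\left(\int\exp(-\xi_1\mathcal L_n(\theta))\,d\Pi_{n,k}(\theta)\right)$, with the same constant $\xi_1$ as in condition (i). Near-optimal index: for $\tau>0$, $k_n^\dagger(\tau)$ is the smallest $k\in[M_n-1]$ with $\mathcal E_n(k)\le(1+\tau)\mathcal E_n(k+1)$, and $k_n^\dagger(\tau)=M_n$ if there is no such $k$. *)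

(* Defs.v *)
From HB Require Import structures.
From mathcomp Require Import all_boot all_order all_algebra.
From mathcomp Require Import all_classical all_reals all_analysis.

Set Implicit Arguments.
Unset Strict Implicit.
Unset Printing Implicit Defensive.

Import Order.TTheory GRing.Theory Num.Theory.
Import numFieldNormedType.Exports.

Local Open Scope classical_set_scope.
Local Open Scope ring_scope.
Local Open Scope ereal_scope.

Section variational_bayes.
Context {R : realType}.

(* The Radon-Nikodym derivative of the library takes a charge as numerator. *)
Definition KL d (T : measurableType d) (P Q : probability T R) : \bar R :=
  if `[< P `<< Q >] then
    \int[P]_x lne (Radon_Nikodym (charge_of_finite_measure P) Q x)
  else +oo.

(* Extended-valued: if the difference of losses is not integrable, the value is
   the one the library gives to the integral (-oo if both the positive and the
   negative part have infinite integral). *)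
Definition excess_risk d (X : measurableType d) (Pstar : probability X R)
    (ell : probability X R -> X -> R) (P : probability X R) : \bar R :=
  'E_Pstar[fun x => (ell P x - ell Pstar x)%R].

(* In the next definitions [ell_x t] is the loss of the parameter [t] on a fixed
   sample [x], and [L t] is its excess risk. *)
Definition VFE d (Theta : measurableType d) (lambda : R) (ell_x : Theta -> R)
    (Pi Q : probability Theta R) : \bar R :=
  lambda%:E * (\int[Q]_t (ell_x t)%:E) + KL Q Pi.

Definition is_variational_posterior d (Theta : measurableType d) (lambda : R)
    (ell_x : Theta -> R) (Pi : probability Theta R)
    (Qfam : set (probability Theta R)) (Qhat : probability Theta R) : Prop :=
  Qfam Qhat /\
  forall Q, Qfam Q -> VFE lambda ell_x Pi Qhat <= VFE lambda ell_x Pi Q.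

Definition model_excess_risk d (Theta : measurableType d) (xi1 : R)
    (L : Theta -> \bar R) (Pi : probability Theta R) : \bar R :=
  - lne (\int[Pi]_t expeR (- (xi1%:E * L t))).

End variational_bayes.

(* Models are numbered from 1 to M.  A smallest index in a set of models is the
   head of the increasing list of its elements, with default value M. *)
Section model_indices.
Context {R : realType}.
Implicit Types (M : nat) (E : nat -> \bar R).

Definition stopping_index M (mVFE : nat -> \bar R) : nat :=
  head M [seq k <- iota 2 M.-1 | mVFE k.-1 < mVFE k].

Definition kdagger M E (tau : R) : nat :=
  head M [seq k <- iota 1 M.-1 | E k <= (1 + tau)%:E * E k.+1].

Definition Estar M E (kdag : nat) : \bar R :=
  \big[Order.min/+oo]_(1 <= k < M.+1 | (k <= kdag.+1)%N) E k.

(* The empty maximum in nat is 0 rather than -oo, which does not matter in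
   [maxn _ kdag]. *)
Definition kcirc M E (kdag : nat) (nu : R) : nat :=
  maxn (\max_(1 <= k < M.+1 |
           (kdag <= k)%N && (E k <= (1 + nu)%:E * Estar M E kdag)) k) kdag.

End model_indices.

(* Main.v *)
(* Let [k = kcirc + 1 <= M].  If the algorithm stops after [k], then mVFE does
   not increase up to [k], so mVFE(k) <= mVFE(k0), where [k0 <= kdag + 1] is an
   index at which E attains its minimum Est.  But mVFE(k) is large: by Gibbs'
   inequality any variational free energy, minus [lambda * ell_star], is at
   least [- log int exp (- lambda (ell - ell_star)) dPi], and the mean of that
   integral is at most [exp (- E k)], so Markov's inequality gives the lower
   bound [(1 + nu) Est / 2] outside an event of probability at most
   [exp (- (1 + nu) Est / 2)].  And mVFE(k0) is small: comparing with the
   distribution of condition (ii), Jensen's and Markov's inequalities bound it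
   (minus [lambda * ell_star]) by [(2 xi4 / xi2 + xi4) Est] outside an event of
   probability at most [exp (- xi4 Est)].  The two bounds are incompatible once
   nu is large.  If Est <= 0 the claimed lower bound on the probability is
   nonpositive, and if Est = +oo then kcirc = M. *)

Require Import Defs.
From HB Require Import structures.
From mathcomp Require Import all_boot all_order all_algebra.
From mathcomp Require Import all_classical all_reals all_analysis.
From mathcomp Require Import measurable_realfun ring lra.

Set Implicit Arguments.
Unset Strict Implicit.
Unset Printing Implicit Defensive.

Import Order.TTheory GRing.Theory Num.Theory.
Import numFieldNormedType.Exports.

Local Open Scope classical_set_scope.
Local Open Scope ring_scope.
Local Open Scope ereal_scope.

(** * Measurability of the extended exponential and logarithm, and comparison of integrals *)

Lemma measurable_expeR (R : realType) : measurable_fun [set: \bar R] (@expeR R).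
Proof.
rewrite (_ : @expeR R = fun x => if x <= -oo then 0 else
    if +oo <= x then +oo else (expR (fine x))%:E); last first.
  by apply/funext => -[r| |].
apply: measurable_fun_if => //; first exact: measurable_fun_lee.
apply: measurable_funTS; apply: measurable_fun_if => //.
  exact: measurable_fun_lee.
apply: measurable_funTS; apply/measurable_EFinP.
exact: measurableT_comp.
Qed.

Lemma measurable_lne (R : realType) : measurable_fun [set: \bar R] (@lne R).
Proof.
rewrite (_ : @lne R = fun x : \bar R => if x <= 0 then -oo : \bar R else
    if +oo <= x then +oo else (ln (fine x))%:E); last first.
  by apply/funext => -[r| |]/=; rewrite ?lee_fin ?leye_eq ?leNye.
apply: measurable_fun_if => //; first exact: measurable_fun_lee.
apply: measurable_funTS; apply: measurable_fun_if => //.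
  exact: measurable_fun_lee.
apply: measurable_funTS; apply/measurable_EFinP.
by apply: measurableT_comp; [exact: measurable_ln|exact: fine_measurable].
Qed.

(** Positive and negative parts are compared separately. Only the minorant is integrable, so [u] can
    be a log-density whose integral is infinite. *)
Lemma ae_integrable_le_integral d (T : measurableType d) (R : realType)
    (mu : {measure set T -> \bar R}) (v u : T -> \bar R) :
  mu.-integrable setT v -> measurable_fun setT u ->
  (\forall t \ae mu, v t <= u t) -> \int[mu]_t v t <= \int[mu]_t u t.
Proof.
move=> iv mfu vu; have mv := measurable_int _ iv.
rewrite integralE [leRHS]integralE leeB//; apply: ae_ge0_le_integral => //;
  do ?[exact: measurable_funepos | exact: measurable_funeneg].
- apply: filterS vu => t vut _.
  by rewrite !funeposE ge_max !le_max lexx orbT andbT vut.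
- apply: filterS vu => t vut _.
  by rewrite !funenegE ge_max !le_max lexx orbT andbT leeN2 vut.
Qed.

Lemma probability_integral_cst d (T : measurableType d) (R : realType)
    (Q : probability T R) (r : \bar R) : \int[Q]_t r = r.
Proof.
by rewrite integral_cst// [X in _ * X](@probability_setT _ _ _ Q) mule1.
Qed.

(** * Gibbs' and Jensen's inequalities *)

Section gibbs.
Context d (T : measurableType d) (R : realType).
Implicit Types (Q P : probability T R) (a : T -> R).

Local Notation "'d Q '/d P" := (Radon_Nikodym_SigmaFinite.f Q P).

(** The two versions of the density agree [P]-almost everywhere, hence [Q]-almost everywhere by
    domination. The one on the right is nonnegative and finite at every point. *)
Lemma KLE Q P : Q `<< P -> KL Q P = \int[Q]_t lne (('d Q '/d P) t).
Proof.
move=> QP; rewrite /KL asboolT//; apply: ae_eq_integral => //.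
- apply: measurableT_comp; first exact: measurable_lne.
  exact: (measurable_int P (Radon_Nikodym_integrable _)).
- apply: measurableT_comp; first exact: measurable_lne.
  exact: (measurable_int P (Radon_Nikodym_SigmaFinite.f_integrable QP)).
- have := ae_eq_Radon_Nikodym_SigmaFinite QP measurableT.
  move/(null_dominates_ae_eq measurableT QP).
  by apply: filterS => t /(_ I) fE _; rewrite fE.
Qed.

(** The [Q]-measure of the set where the density is at most 0 is the [P]-integral of the density
    over that set, and the density is 0 there. *)
Lemma Radon_Nikodym_gt0 Q P : Q `<< P -> \forall t \ae Q, 0 < ('d Q '/d P) t.
Proof.
move=> QP; set f := 'd Q '/d P.
have mf : measurable_fun setT f.
  exact: (measurable_int P (Radon_Nikodym_SigmaFinite.f_integrable QP)).
exists [set t | f t <= 0]; split.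
- by rewrite -[X in measurable X]setTI; exact: emeasurable_fun_infty_c.
- rewrite (Radon_Nikodym_SigmaFinite.f_integral QP); last first.
    by rewrite -[X in measurable X]setTI; exact: emeasurable_fun_infty_c.
  apply: integral0_eq => t /= ft; apply/eqP; rewrite eq_le ft.
  exact: Radon_Nikodym_SigmaFinite.f_ge0.
- by move=> t /= /negP; rewrite -leNgt.
Qed.

(* [1 + s <= exp s] at [s = c - a - log (dQ/dP)], integrated against [Q]. *)
Lemma gibbs_integrable Q P a (c : R) : Q.-integrable setT (EFin \o a) ->
  \int[P]_t (expR (c - a t))%:E <= 1 ->
  c%:E - \int[Q]_t (a t)%:E <= KL Q P.
Proof.
move=> ia le1.
have [QP|nQP] := pselect (Q `<< P); last by rewrite /KL asboolF// leey.
rewrite KLE//; set f := 'd Q '/d P.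
have ma : measurable_fun setT a.
  by apply/measurable_EFinP; exact: measurable_int ia.
have mf : measurable_fun setT f.
  exact: (measurable_int P (Radon_Nikodym_SigmaFinite.f_integrable QP)).
have f0 t : 0 <= f t by exact: Radon_Nikodym_SigmaFinite.f_ge0.
have ffin t : f t \is a fin_num by exact: Radon_Nikodym_SigmaFinite.f_fin_num.
have me : measurable_fun setT (fun t => expR (c - a t)).
  by apply: measurableT_comp => //; exact: measurable_funB.
pose h t := (expR (c - a t - ln (fine (f t))))%:E.
have h0 t : 0 <= h t.
  by rewrite lee_fin expR_ge0.
have mh : measurable_fun setT h.
  apply/measurable_EFinP; apply: measurableT_comp => //.
  apply: measurable_funB; first exact: measurable_funB.
  apply: measurableT_comp; first exact: measurable_ln.
  by apply: measurableT_comp; [exact: fine_measurable|].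
(* Change of variables gives the [P]-integral of [h * f]. Where [f] is positive it cancels, leaving
   [expR (c - a t)]; where [f] vanishes the product is 0. *)
have h1 : \int[Q]_t h t <= 1.
  rewrite -(Radon_Nikodym_SigmaFinite.change_of_variables QP)//.
  apply: le_trans le1; apply: ge0_le_integral => //.
  - by move=> t _; rewrite mule_ge0.
  - exact: emeasurable_funM.
  - exact/measurable_EFinP.
  - move=> t _; rewrite -/(f t) -[X in _ * X](fineK (ffin t)) -EFinM lee_fin.
    have := fine_ge0 (f0 t); rewrite le_eqVlt => /predU1P[<-|ft0].
      by rewrite mulr0 expR_ge0.
    by rewrite expRB lnK ?posrE// divfK// gt_eqF.
have ih : Q.-integrable setT h.
  apply/integrableP; split => //.
  under eq_integral do rewrite gee0_abs//.
  by rewrite (le_lt_trans h1)// ltry.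
pose v t := ((1 + c)%:E - (a t)%:E) - h t.
have ic : Q.-integrable setT (cst (1 + c)%:E).
  exact: finite_measure_integrable_cst.
have ica : Q.-integrable setT (fun t => (1 + c)%:E - (a t)%:E).
  exact: (integrableB measurableT ic ia).
have iv : Q.-integrable setT v by exact: integrableB.
have ve : \int[Q]_t v t = (1 + c)%:E - \int[Q]_t (a t)%:E - \int[Q]_t h t.
  by rewrite integralB// integralB// probability_integral_cst.
apply: (@le_trans _ _ (\int[Q]_t v t)).
  rewrite ve.
  have : \int[Q]_t (a t)%:E \is a fin_num by exact: integrable_fin_num ia.
  have : \int[Q]_t h t \is a fin_num by exact: integrable_fin_num ih.
  move: h1; case: (\int[Q]_t h t) => //; case: (\int[Q]_t (a t)%:E) => // r s.
  by rewrite -!EFinB !lee_fin => h1 _ _; lra.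
apply: ae_integrable_le_integral => //.
  by apply: measurableT_comp => //; exact: measurable_lne.
apply: filterS (Radon_Nikodym_gt0 QP) => t; rewrite -/f /v /h.
rewrite -(fineK (ffin t)) lte_fin => ft0; rewrite lne_EFin//= -!EFinB lee_fin.
have := expR_ge1Dx (c - a t - ln (fine (f t))).
by lra.
Qed.

Lemma KL_ge0 Q P : 0 <= KL Q P.
Proof.
have := @gibbs_integrable Q P (cst 0%R) 0%R.
rewrite /comp/= integral0 sube0; apply; first exact: integrable0.
under eq_integral do rewrite subr0 expR0.
by rewrite probability_integral_cst.
Qed.

(** If the integral of [a] is infinite, so is the right-hand side: [KL_ge0] excludes the sum of
    [+oo] and [-oo]. Otherwise [a] is integrable. *)
Lemma gibbs Q P a (c : R) : measurable_fun setT a -> (forall t, 0 <= a t)%R ->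
  \int[P]_t (expR (c - a t))%:E <= 1 ->
  c%:E <= \int[Q]_t (a t)%:E + KL Q P.
Proof.
move=> ma a0 le1.
have [afin|] := ltP (\int[Q]_t (a t)%:E) +oo; last first.
  rewrite leye_eq => /eqP ->; rewrite addye ?leey//.
  by rewrite gt_eqF// (lt_le_trans _ (KL_ge0 _ _)).
have ia : Q.-integrable setT (EFin \o a).
  apply/integrableP; split; first exact/measurable_EFinP.
  by under eq_integral do rewrite /= ger0_norm//.
rewrite addeC -leeBlDr; last exact: integrable_fin_num ia.
exact: gibbs_integrable.
Qed.

End gibbs.

(** Jensen's inequality for the exponential, by its tangent: [1 + y <= expR y] at [y = a t - s - c]
    is integrated against [Q]. *)
Lemma integral_le_log_integral_expR d (T : measurableType d) (R : realType)
    (Q : probability T R) (a : T -> R) (s c : R) :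
  measurable_fun setT a -> (forall t, 0 <= a t)%R ->
  \int[Q]_t (expR (a t - s))%:E <= (expR c)%:E ->
  \int[Q]_t (a t)%:E <= (s + c)%:E.
Proof.
move=> ma a0 le_c.
pose w t := (expR (a t - s))%:E.
have mw : measurable_fun setT w.
  by apply/measurable_EFinP; apply: measurableT_comp => //;
     exact: measurable_funB.
have w0 t : 0 <= w t by rewrite lee_fin expR_ge0.
have iw : Q.-integrable setT w.
  apply/integrableP; split => //.
  under eq_integral do rewrite gee0_abs//.
  by rewrite (le_lt_trans le_c)// ltry.
have iZw : Q.-integrable setT (fun t => (expR (- c))%:E * w t).
  exact: integrableZl.
have icst : Q.-integrable setT (cst (s + c - 1)%:E).
  exact: finite_measure_integrable_cst.
have aw t : (a t)%:E <= (s + c - 1)%:E + (expR (- c))%:E * w t.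
  rewrite /w -EFinM -EFinD lee_fin -expRD.
  by have := expR_ge1Dx (- c + (a t - s)); lra.
apply: (@le_trans _ _ (\int[Q]_t ((s + c - 1)%:E + (expR (- c))%:E * w t))).
  apply: ge0_le_integral => //.
  - by move=> t _; rewrite lee_fin.
  - exact/measurable_EFinP.
  - by apply: emeasurable_funD => //; exact: emeasurable_funM.
rewrite integralD// integralZl// probability_integral_cst.
have -> : (s + c)%:E = (s + c - 1)%:E + (expR (- c))%:E * (expR c)%:E.
  by rewrite -EFinM -EFinD -expRD addNr expR0 subrK.
by rewrite leeD2l// lee_pmul2l// lte_fin expR_gt0.
Qed.

(** * Integrals over parameter and sample: measurability, Tonelli and Markov *)

Section parameter_integrals.
Context d d' (T : measurableType d) (X : measurableType d') (R : realType).

(** Since [g] may change sign, as a difference of losses does, Tonelli's theorem is applied to its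
    positive and negative parts. *)
Lemma measurable_integral_parameter (mu : probability X R) (g : T * X -> R) :
  measurable_fun setT g ->
  measurable_fun setT (fun t => \int[mu]_x (g (t, x))%:E).
Proof.
move=> /measurable_EFinP mg.
rewrite (_ : (fun t => _) =
    fun t => fubini_F mu ((EFin \o g)^\+) t - fubini_F mu ((EFin \o g)^\-) t).
  apply: emeasurable_funB; apply: measurable_fun_fubini_tonelli_F => //.
  - exact: measurable_funepos.
  - exact: measurable_funeneg.
apply/funext => t; rewrite integralE /fubini_F.
by congr (_ - _); apply: eq_integral => x _; rewrite ?funeposE ?funenegE.
Qed.

Variables (mu : probability X R) (nu : probability T R) (g : T * X -> R).
Hypothesis mg : measurable_fun setT g.
Hypothesis g0 : forall z, (0 <= g z)%R.

Lemma measurable_exceedance (r : R) :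
  measurable [set x | r%:E <= \int[nu]_t (g (t, x))%:E].
Proof.
rewrite -[X in measurable X]setTI; apply: emeasurable_fun_c_infty => //.
apply: (measurable_fun_fubini_tonelli_G (m1 := nu) (fun z => (g z)%:E)).
  exact/measurable_EFinP.
by move=> z; rewrite lee_fin.
Qed.

(** Tonelli's theorem turns the hypothesis into a bound on a mean under [mu], to which Markov's
    inequality applies at level [expR r]. *)
Lemma markov_fubini (b r : R) :
  \int[nu]_t \int[mu]_x (g (t, x))%:E <= (expR b)%:E ->
  mu [set x | (expR r)%:E <= \int[nu]_t (g (t, x))%:E] <= (expR (b - r))%:E.
Proof.
have mG : measurable_fun setT (fun x => \int[nu]_t (g (t, x))%:E).
  apply: (measurable_fun_fubini_tonelli_G (m1 := nu) (fun z => (g z)%:E)).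
    exact/measurable_EFinP.
  by move=> z; rewrite lee_fin.
rewrite (fubini_tonelli (m1 := nu) (m2 := mu) (fun z => (g z)%:E)); last 2 first.
- exact/measurable_EFinP.
- by move=> z; rewrite lee_fin.
move=> le_b; have er0 := expR_gt0 r.
have := le_integral_abse mu measurableT mG er0.
have -> : \int[mu]_x `|\int[nu]_t (g (t, x))%:E| =
    \int[mu]_x \int[nu]_t (g (t, x))%:E.
  apply: eq_integral => x _.
  by rewrite gee0_abs// integral_ge0// => t _; rewrite lee_fin.
have -> : [set: X] `&` [set x | (expR r)%:E <= `|\int[nu]_t (g (t, x))%:E|] =
    [set x | (expR r)%:E <= \int[nu]_t (g (t, x))%:E].
  rewrite setTI; apply/seteqP; split => x /=;
  by rewrite gee0_abs// integral_ge0// => t _; rewrite lee_fin.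
move=> /le_trans/(_ le_b) mu_le.
by rewrite -(@lee_pmul2l _ (expR r)%:E)// -EFinM -expRD addrC subrK.
Qed.

End parameter_integrals.

(** * Extremal properties of the model indices *)

Lemma ltn_head_filter (p : pred nat) (x0 m n j : nat) :
  j \in iota m n -> (j < head x0 [seq k <- iota m n | p k])%N -> ~~ p j.
Proof.
move=> jmn; apply: contraL => pj.
have : j \in [seq k <- iota m n | p k] by rewrite mem_filter pj.
have : sorted ltn [seq k <- iota m n | p k].
  by apply: sorted_filter; [exact: ltn_trans | exact: iota_ltn_sorted].
case: [seq k <- iota m n | p k] => //= h s hs.
rewrite inE -leqNgt => /predU1P[->//|js].
exact: ltnW (allP (order_path_min ltn_trans hs) j js).
Qed.

Section indices.
Context {R : realType}.
Implicit Types (M : nat) (f E : nat -> \bar R).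

Lemma stopping_index_le M f : (0 < M)%N -> (stopping_index M f <= M)%N.
Proof.
move=> M0; rewrite /stopping_index; set s := [seq _ <- _ | _].
have : all (leq^~ M) s.
  apply/allP => k; rewrite mem_filter mem_iota => /and3P[_ _].
  by rewrite addSn addSn add0n ltnS prednK.
by case: s => //= h s /andP[].
Qed.

Lemma kdagger_le M E tau : (0 < M)%N -> (kdagger M E tau <= M)%N.
Proof.
move=> M0; rewrite /kdagger; set s := [seq _ <- _ | _].
have : all (leq^~ M) s.
  apply/allP => k; rewrite mem_filter mem_iota => /and3P[_ _].
  by rewrite add1n prednK// => /ltnW.
by case: s => //= h s /andP[].
Qed.

(** The indices from 2 to [k] precede the stopping index, so none of them passes the test
    [f k.-1 < f k]. *)
Lemma stopping_index_nonincreasing M f j k : (0 < M)%N ->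
  (0 < j <= k)%N -> (k < stopping_index M f)%N -> f k <= f j.
Proof.
move=> M0 /andP[j0]; elim: k => [|k IH]; first by rewrite leqn0 => /eqP ->.
rewrite leq_eqVlt => /predU1P[->//|jk] kM.
have := ltn_head_filter _ kM; rewrite -leNgt => fk.
apply: le_trans (fk _) (IH _ _) => //; last exact: ltnW.
rewrite mem_iota ltnS (leq_trans j0)//= addSn addSn add0n ltnS prednK//.
by rewrite (leq_trans (ltnW kM))// stopping_index_le.
Qed.

(** The fold starts from [+oo], and each step keeps the current value or replaces it by some
    [E k]. *)
Lemma Estar_attained M E kdag : Estar M E kdag = +oo \/
  exists k, [/\ (0 < k <= M)%N, (k <= kdag.+1)%N & E k = Estar M E kdag].
Proof.
rewrite /Estar big_seq_cond.
elim/big_rec: _ => [|k x /andP[]]; first by left.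
rewrite mem_index_iota ltnS => kM kdag_k IH.
by case: (leP (E k) x) => _ //; right; exists k.
Qed.

Lemma leq_kcirc M E kdag nu k : (0 < k <= M)%N -> (kdag <= k)%N ->
  E k <= (1 + nu)%:E * Estar M E kdag -> (k <= kcirc M E kdag nu)%N.
Proof.
move=> kM kdag_k Ek; apply: leq_trans (leq_maxl _ _).
by apply: leq_bigmax_seq; rewrite ?mem_index_iota ?ltnS// kdag_k Ek.
Qed.

End indices.

(** * Tail bounds for the variational free energy of one model *)

Section one_model.
Context d d' (T : measurableType d) (X : measurableType d') (R : realType).
Variables (Pstar : probability X R) (P : T -> probability X R).
Variable ell : probability X R -> X -> R.
Hypothesis ell0 : forall p x, (0 <= ell p x)%R.
Hypothesis mellstar : measurable_fun setT (ell Pstar).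
Hypothesis mell : measurable_fun setT (fun z : T * X => ell (P z.1) z.2).
Variable lambda : R.
Hypothesis lambda0 : (0 < lambda)%R.

Let L t := excess_risk Pstar ell (P t).

Lemma measurable_loss_difference :
  measurable_fun setT (fun z : T * X => ell (P z.1) z.2 - ell Pstar z.2)%R.
Proof. by apply: measurable_funB => //; exact: measurableT_comp. Qed.

Lemma measurable_excess_risk : measurable_fun setT L.
Proof.
rewrite /L /excess_risk unlock.
exact: (measurable_integral_parameter Pstar measurable_loss_difference).
Qed.

Lemma measurable_loss x : measurable_fun setT (fun t => ell (P t) x).
Proof. exact: (measurable_fun_pair1 x mell). Qed.

Lemma measurable_expR_loss_difference (k : R) :
  measurable_fun setT
    (fun z : T * X => expR (k * (ell (P z.1) z.2 - ell Pstar z.2))%R).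
Proof.
apply: measurableT_comp => //; apply: measurable_funM => //.
exact: measurable_loss_difference.
Qed.

(** Brings both halves of condition (i) to the form that [markov_fubini] takes: [xi] is [- xi1] with
    the prior, and [xi3] with the distribution of condition (ii). *)
Lemma exponential_moment_integral (Q : probability T R) (k xi b : R) :
  (forall t, 'E_Pstar[fun x => expR (k * (ell (P t) x - ell Pstar x))%R]
    <= expeR (xi%:E * L t)) ->
  lne (\int[Q]_t expeR (xi%:E * L t)) <= b%:E ->
  \int[Q]_t \int[Pstar]_x (expR (k * (ell (P t) x - ell Pstar x)))%:E
    <= (expR b)%:E.
Proof.
rewrite unlock => moment le_b; rewrite -[leRHS]/(expeR b%:E).
apply: (@le_trans _ _ (\int[Q]_t expeR (xi%:E * L t))); last first.
  rewrite -[leLHS]lneK ?lee_expeR// in_itv/= leey andbT.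
  by apply: integral_ge0 => t _; exact: expeR_ge0.
apply: ge0_le_integral => //.
- by move=> t _; apply: integral_ge0 => x _; rewrite lee_fin expR_ge0.
- exact: (measurable_integral_parameter Pstar (measurable_expR_loss_difference k)).
- apply: measurableT_comp; first exact: measurable_expeR.
  by apply: emeasurable_funM => //; exact: measurable_excess_risk.
Qed.

(** Half of [s] pays for the probability and half for the bound. The event involves the prior alone,
    so the bound holds for all [Q] at once, in particular for a [Q] that depends on the sample. *)
Lemma VFE_lower_tail (Pi : probability T R) (xi1 s : R) :
  (forall t, 'E_Pstar[fun x => expR (- lambda * (ell (P t) x - ell Pstar x))%R]
    <= expeR (- (xi1%:E * L t))) ->
  s%:E <= model_excess_risk xi1 L Pi ->
  exists A : set X, [/\ measurable A, Pstar A <= (expR (- (s / 2)))%:E &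
    forall x, ~ A x -> forall Q,
      (lambda * ell Pstar x + s / 2)%:E
        <= VFE lambda (fun t => ell (P t) x) Pi Q].
Proof.
move=> moment s_le.
pose g (z : T * X) := expR (- lambda * (ell (P z.1) z.2 - ell Pstar z.2))%R.
have mg : measurable_fun setT g by exact: measurable_expR_loss_difference.
have g0 z : (0 <= g z)%R by exact: expR_ge0.
exists [set x | (expR (- (s / 2)))%:E <= \int[Pi]_t (g (t, x))%:E]; split.
- exact: measurable_exceedance.
- rewrite [X in _ <= (expR X)%:E](_ : _ = - s - (- (s / 2)))%R; last by lra.
  apply: (markov_fubini mg g0).
  apply: (@exponential_moment_integral _ _ (- xi1)%R).
    by move=> t; rewrite EFinN mulNe.
  rewrite (EFinN s) leeNr; apply: (le_trans s_le); rewrite leeN2.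
  by under [X in lne X]eq_integral do rewrite EFinN mulNe.
- move=> x /negP; rewrite -ltNge => Zx Q; rewrite /VFE -ge0_integralZl_EFin
    ?(ltW lambda0)//.
  (* Here [c] is [lambda * ell Pstar x + s / 2], so the integrand in [gibbs] is [expR (s / 2)] times
     [g]; off the event, the integral of [g] is below [expR (- (s / 2))]. *)
  + have := @gibbs _ _ _ Q Pi (fun t => lambda * ell (P t) x)%R.
    apply.
    * by apply: measurable_funM => //; exact: measurable_loss.
    * by move=> t; rewrite mulr_ge0// ltW.
    * apply: (@le_trans _ _
        (\int[Pi]_t ((expR (s / 2))%:E * (g (t, x))%:E))).
        rewrite le_eqVlt; apply/orP; left; apply/eqP/eq_integral => t _.
        by rewrite -EFinM -expRD; congr (expR _)%:E; ring.
      rewrite ge0_integralZl_EFin ?expR_ge0//; last 2 first.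
        by move=> t _; rewrite lee_fin.
        by apply/measurable_EFinP; exact: (measurable_fun_pair1 x mg).
      have -> : 1 = (expR (s / 2))%:E * (expR (- (s / 2)))%:E :> \bar R.
        by rewrite -EFinM -expRD subrr expR0.
      by rewrite lee_pmul2l ?lte_fin ?expR_gt0// ltW.
  + by move=> t _; rewrite lee_fin.
  + by apply/measurable_EFinP; exact: measurable_loss.
Qed.

(** The mean of the exponential integral is at most [expR e], so the level [expR (2 * e)] is reached
    with probability at most [expR (- e)]. Below that level Jensen's inequality bounds the loss
    term, and the divergence adds [e]. *)
Lemma VFE_upper_tail (Pi Q : probability T R) (xi2 xi3 e : R) : (0 < xi2)%R ->
  (forall t, 'E_Pstar[fun x =>
      expR (lambda * xi2 * (ell (P t) x - ell Pstar x))%R]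
    <= expeR (xi3%:E * L t)) ->
  lne (\int[Q]_t expeR (xi3%:E * L t)) <= e%:E -> KL Q Pi <= e%:E ->
  exists A : set X, [/\ measurable A, Pstar A <= (expR (- e))%:E &
    forall x, ~ A x ->
      VFE lambda (fun t => ell (P t) x) Pi Q
        <= (lambda * ell Pstar x + (2 * e / xi2 + e))%:E].
Proof.
move=> xi20 moment le_e KL_e.
pose g (z : T * X) := expR (lambda * xi2 * (ell (P z.1) z.2 - ell Pstar z.2))%R.
have mg : measurable_fun setT g by exact: measurable_expR_loss_difference.
have g0 z : (0 <= g z)%R by exact: expR_ge0.
exists [set x | (expR (2 * e))%:E <= \int[Q]_t (g (t, x))%:E]; split.
- exact: measurable_exceedance.
- have -> : (- e = e - 2 * e)%R by ring.
  apply: (markov_fubini mg g0).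
  exact: (exponential_moment_integral moment).
- move=> x /negP; rewrite -ltNge => Wx; rewrite /VFE addrA EFinD leeD//.
  have mlx := measurable_loss x.
  have lx0 : (0 < lambda * xi2)%R by rewrite mulr_gt0.
  have := @integral_le_log_integral_expR _ _ _ Q
    (fun t => lambda * xi2 * ell (P t) x)%R (lambda * xi2 * ell Pstar x)%R (2 * e)%R.
  (* Both sides of Jensen's bound are written as multiples of [xi2], which cancels and leaves
     [2 * e / xi2]. *)
  have -> : \int[Q]_t (lambda * xi2 * ell (P t) x)%:E =
      (xi2)%:E * (lambda%:E * \int[Q]_t (ell (P t) x)%:E).
    under eq_integral do rewrite EFinM.
    rewrite ge0_integralZl_EFin//.
    + by rewrite muleA -EFinM (mulrC xi2).
    + by move=> t _; rewrite lee_fin.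
    + exact/measurable_EFinP.
    + exact: ltW.
  have -> : (lambda * xi2 * ell Pstar x + 2 * e)%:E =
      xi2%:E * (lambda * ell Pstar x + 2 * e / xi2)%:E.
    by rewrite -EFinM; congr _%:E; field; rewrite gt_eqF.
  rewrite lee_pmul2l//; apply.
  + exact: measurable_funM.
  + by move=> t; rewrite mulr_ge0// ltW.
  + apply: le_trans (ltW Wx); rewrite le_eqVlt; apply/orP; left; apply/eqP.
    by apply: eq_integral => t _; rewrite /g/= mulrBr.
Qed.

End one_model.

(** * Choice of the constants and combination of the two tail bounds *)

Theorem theorem3p4 (R : realType)
  (* samples, true distributions, models *)
  (dX : nat -> measure_display) (X : forall n, measurableType (dX n))
  (Pstar : forall n, probability (X n) R)
  (M : nat -> nat) (hM : forall n, (0 < M n)%N)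
  (dT : nat -> nat -> measure_display)
  (Theta : forall n k, measurableType (dT n k))
  (P : forall n k, Theta n k -> probability (X n) R)
  (* nested models *)
  (hnest : forall n k, (0 < k < M n)%N ->
     exists2 T : Theta n k -> Theta n k.+1, injective T &
       forall t A, measurable A -> P n k t A = P n k.+1 (T t) A)
  (* loss *)
  (ell : forall n, probability (X n) R -> X n -> R)
  (hell0 : forall n p x, (0 <= ell n p x)%R)
  (hellstar : forall n, measurable_fun [set: X n] (ell n (Pstar n)))
  (hell : forall n k, (0 < k <= M n)%N ->
     measurable_fun [set: Theta n k * X n]
       (fun z : Theta n k * X n => ell n (P n k z.1) z.2))
  (* variational Bayes *)
  (lambda : R) (hlambda : (0 < lambda)%R)
  (Pi : forall n k, probability (Theta n k) R)
  (Qfam : forall n k, set (probability (Theta n k) R))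
  (Qhat : forall n k, X n -> probability (Theta n k) R)
  (hQhat : forall n k, (0 < k <= M n)%N -> forall x,
     is_variational_posterior lambda (fun t => ell n (P n k t) x)
       (Pi n k) (Qfam n k) (Qhat n k x))
  (* constants *)
  (xi1 xi2 xi3 xi4 : R)
  (hxi1 : (0 < xi1)%R) (hxi2 : (0 < xi2)%R)
  (hxi3 : (0 < xi3)%R) (hxi4 : (0 < xi4)%R)
  (tau C2 : R) (htau : (0 < tau)%R) (hC2 : (0 < C2)%R) :
  let L n k (t : Theta n k) := excess_risk (Pstar n) (ell n) (P n k t) in
  let E n k := model_excess_risk xi1 (L n k) (Pi n k) in
  let mVFE n x k :=
    VFE lambda (fun t => ell n (P n k t) x) (Pi n k) (Qhat n k x) in
  let mhat n x := stopping_index (M n) (mVFE n x) in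
  let kdag n := kdagger (M n) (E n) tau in
  let Est n := Estar (M n) (E n) (kdag n) in
  (* the stopping index is a random variable *)
  (forall n, measurable_fun [set: X n] (mhat n)) ->
  (* condition (i) *)
  (\forall n \near \oo, forall k (t : Theta n k), (0 < k <= M n)%N ->
     'E_(Pstar n)[fun x =>
        expR (- lambda * (ell n (P n k t) x - ell n (Pstar n) x))%R]
       <= expeR (- (xi1%:E * L n k t)) /\
     'E_(Pstar n)[fun x =>
        expR (lambda * xi2 * (ell n (P n k t) x - ell n (Pstar n) x))%R]
       <= expeR (xi3%:E * L n k t)) ->
  (* condition (ii) *)
  (\forall n \near \oo, forall k, (0 < k <= M n)%N ->
     exists2 Q, Qfam n k Q &
       lne (\int[Q]_t expeR (xi3%:E * L n k t)) <= xi4%:E * E n k /\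
       KL Q (Pi n k) <= xi4%:E * E n k) ->
  (* lower bound on the stopping index *)
  (\forall n \near \oo,
     1 - (kdag n)%:R%:E * expeR (- (C2%:E * E n (kdag n)))
       <= Pstar n [set x | (minn (kdag n).+1 (M n) <= mhat n x)%N]) ->
  exists nu C3 : R, [/\ (0 < nu)%R, (0 < C3)%R &
    \forall n \near \oo,
      1 - 2%:E * expeR (- (C3%:E * Est n))
        <= Pstar n [set x |
             (mhat n x <= (kcirc (M n) (E n) (kdag n) nu).+1)%N]].
Proof.
move=> L E mVFE mhat kdag Est mmhat moments approx _.
(* With [e] the value of [Est n], this [nu] makes the lower bound [(1 + nu) * e / 2] exceed the
   upper bound by exactly [e]. [C3] is at most both [xi4] and 1, to cover the two failure
   probabilities. *)
exists (4 * xi4 / xi2 + 2 * xi4 + 1)%R, (Num.min xi4 1)%R.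
set nu := (4 * xi4 / xi2 + _ + _)%R; set C3 := Num.min _ _.
have nu0 : (0 < nu)%R by rewrite !addr_gt0 ?divr_gt0 ?mulr_gt0.
have nu10 : (0 < 1 + nu)%R by rewrite addr_gt0.
have C30 : (0 < C3)%R by rewrite lt_min hxi4 ltr01.
split => //; apply: filterS2 moments approx => n moments approx.
set kc := kcirc _ _ _ _.
have mhatM x : (mhat n x <= M n)%N by exact: stopping_index_le.
have kdag_kc : (kdag n <= kc)%N by exact: leq_maxr.
have [Mkc|kcM] := leqP (M n) kc.+1.
  have -> : [set x | (mhat n x <= kc.+1)%N] = setT.
    by apply/seteqP; split => x //= _; exact: leq_trans (mhatM x) Mkc.
  by rewrite probability_setT -[leRHS]sube0 leeB// mule_ge0// expeR_ge0.
(* The index [kc.+1] is a valid model beyond [kdag n], so the maximality of [kc] rules out the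
   reverse inequality. *)
have Ekc : (1 + nu)%:E * Est n < E n kc.+1.
  rewrite ltNge; apply/negP => /leq_kcirc; rewrite ltnS leq0n ltnW//= ltnn.
  by move=> /(_ isT (leqW kdag_kc)).
have [Est_le0|Est_gt0] := leP (Est n) 0.
  apply: le_trans (measure_ge0 _ _).
  have exp1 : 1 <= expeR (- (C3%:E * Est n)).
    by rewrite -expeR0 lee_expeR oppe_ge0 mule_ge0_le0// lee_fin ltW.
  rewrite sube_le0 (le_trans exp1)// -[leLHS]mul1e lee_wpmul2r ?expeR_ge0//.
  by rewrite lee_fin ler1n.
(* An infinite minimum contradicts the strict inequality [Ekc]. *)
have [Esty|[k0 [k0M k0kdag k0E]]] := Estar_attained (M n) (E n) (kdag n).
  move: Ekc; rewrite /Est Esty gt0_muley ?lte_fin//.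
  by rewrite ltNge leey.
have [e Ee] : exists e : R, Est n = e%:E.
  case: (Est n) Est_gt0 Ekc => [r| |//] _; first by exists r.
  by rewrite gt0_muley ?lte_fin// ltNge leey.
have e0 : (0 < e)%R by rewrite -lte_fin -Ee.
have half_e : ((1 + nu) * e / 2 = 2 * (xi4 * e) / xi2 + xi4 * e + e)%R.
  by rewrite /nu; field; rewrite gt_eqF.
have kcM' : (0 < kc.+1 <= M n)%N by rewrite /= ltnW.
have [|A [mA PA HA]] := @VFE_lower_tail _ _ _ _ _ (Pstar n) (P n kc.+1)
    (ell n) (hell0 n) (hellstar n) (hell n _ kcM') _ hlambda (Pi n kc.+1) xi1
    ((1 + nu) * e)%R (fun t => (moments kc.+1 t kcM').1).
  by rewrite EFinM -Ee ltW.
have [Q QQ [Q1 Q2]] := approx _ k0M.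
have E0 : xi4%:E * E n k0 = (xi4 * e)%:E by rewrite EFinM -Ee k0E.
rewrite E0 in Q1 Q2.
have [B [mB PB HB]] := @VFE_upper_tail _ _ _ _ _ (Pstar n) (P n k0)
    (ell n) (hell0 n) (hellstar n) (hell n _ k0M) _ hlambda (Pi n k0) Q xi2 xi3
    (xi4 * e)%R hxi2 (fun t => (moments k0 t k0M).2) Q1 Q2.
pose S := [set x | (mhat n x <= kc.+1)%N].
have mS : measurable S.
  by rewrite -[S]setTI; exact: (mmhat n measurableT [set k | (k <= kc.+1)%N]).
have SAB : ~` S `<=` A `|` B.
  move=> x /= /negP; rewrite -ltnNge => kc_lt.
  have [Ax|nA] := pselect (A x); first by left.
  have [Bx|nB] := pselect (B x); first by right.
  exfalso.
  have : mVFE n x kc.+1 <= mVFE n x k0.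
    (* The order [k0 <= (kdag n).+1 <= kc.+1] holds because the minimum [Est n] stops at
       [(kdag n).+1]. *)
    apply: (stopping_index_nonincreasing (hM n) _ (kc_lt : (_ < mhat n x)%N)).
    by case/andP: k0M => -> _; rewrite (leq_trans k0kdag).
  apply/negP; rewrite -ltNge.
  (* The minimizer for model [k0] does at least as well as the distribution [Q] of condition
     (ii). *)
  apply: le_lt_trans ((hQhat n k0 k0M x).2 Q QQ) _.
  apply: le_lt_trans (HB x nB) _.
  apply: lt_le_trans (HA x nA _).
  rewrite lte_fin ltrD2l.
  by rewrite half_e ltrDl.
have PSC : Pstar n (~` S) <= 2%:E * expeR (- (C3%:E * Est n)).
  apply: (@le_trans _ _ (Pstar n A + Pstar n B)).
    apply: le_trans (measureU2 _ mA mB).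
    apply: le_measure => //; rewrite inE; first exact: measurableC.
    exact: measurableU.
  apply: le_trans (leeD PA PB) _.
  rewrite Ee -EFinM -EFinD lee_fin mulr_natl mulr2n.
  rewrite lerD// ler_expR lerN2.
    (* For [A], the exponents compare as [C3 * e <= e <= (1 + nu) * e / 2]; for [B], as
       [C3 * e <= xi4 * e]. *)
    apply: (@le_trans _ _ e); first by rewrite ler_piMl ?ge_min ?lexx ?orbT// ltW.
    have : (0 <= 2 * (xi4 * e) / xi2 + xi4 * e)%R.
      by rewrite addr_ge0// ?divr_ge0 ?mulr_ge0// ltW.
    by rewrite half_e lerDr.
  by rewrite ler_wpM2r ?ge_min ?lexx// ltW.
rewrite leeBlDr; last by rewrite Ee.
rewrite -(@probability_setT _ _ _ (Pstar n)) -(setUv S).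
apply: le_trans (measureU2 _ mS (measurableC mS)) _.
by rewrite leeD2l.
Qed.
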